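(* There exists an absolute constant $c_1$ for which the following holds. Let $\mathcal F\subset L_2(\mu)$ be a class of functions, let $X\sim\mu$, set $W\sim\mathcal N(0,\sigma^2)$ independent of $X$, and for every $f\in\mathcal F$ put $Y^f=f(X)+W$. If a learning procedure $\tilde f_N$ performs with a confidence parameter $\delta_N<1/4$ for every such target $Y^f$, then its accuracy cannot be better than $$c_1\,\big(q_N^*(c_1/\sigma)\big)^2 ;$$ that is, if $\tilde f_N$ performs with accuracy $\varepsilon_N$ and confidence parameter $\delta_N<1/4$ for every target $Y^f$, $f\in\mathcal F$, then $\varepsilon_N\ge c_1\big(q_N^*(c_1/\sigma)\big)^2$.
   Context: $\mu$ is a probability measure on a space $\Omega$. A learning procedure is a map $\tilde f_N$ from $(\Omega\times\mathbb R)^N$ into $\mathcal F$. It performs with accuracy $\varepsilon_N$ and confidence parameter $\delta_N$ for the target $Y$ if, when applied to $N$ i.i.d. copies $(X_i,Y_i)_{i=1}^N$ of $(X,Y)$, with probability at least $1-\delta_N$ one has $R(\tilde f_N)\le\inf_{f\in\mathcal F}R(f)+\varepsilon_N$, where $R(f)=\mathbb E(f(X)-Y)^2$ and $R(\tilde f_N)$ is the conditional expectation of $(\tilde f_N(X)-Y)^2$ given the data, $(X,Y)$ being independent of the data. $rD=\{h\in L_2(\mu):\|h\|_{L_2(\mu)}\le r\}$, $\mathcal F-f=\{h-f:h\in\mathcal F\}$, and $N(A,B)$ is the smallest number of translates of $B$ needed to cover $A$. Put $$C(r)=\sup_{f\in\mathcal F}\,r\,\log^{1/2}N\big((\mathcal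 F-f)\cap2rD,\,rD\big),\qquad q_N^*(\eta)=\inf\{s>0:\ C(s)\le\eta s^2\sqrt N\}.$$
   Formalization: The single absolute constant c_1 is split into two absolute constants, c_1 as the outer factor and c_1' inside q_N^*(c_1'/sigma), because with the same number in both places the claim fails for every c_1 > 0. *)

(* Defs.v *)
From mathcomp Require Import all_boot all_order all_algebra.
From mathcomp Require Import all_classical all_reals all_analysis.

Set Implicit Arguments.
Unset Strict Implicit.
Unset Printing Implicit Defensive.

Import Order.TTheory GRing.Theory Num.Theory.
Import numFieldNormedType.Exports.

Local Open Scope classical_set_scope.
Local Open Scope ring_scope.

(* The least number of translates of B that cover A; +oo if no finite number
   suffices. *)
Definition covering_number (R : realType) (V : zmodType) (A B : set V)
    : \bar R :=
  ereal_inf [set (n%:R)%:E | n in [set n : nat |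
    exists c : 'I_n -> V,
      A `<=` [set h | exists i, exists2 b, B b & h = c i + b]]].

(* In the covering numbers below the centers of the translates range over all
   functions; a translate of L2ball by a function outside L_2(mu) contains no
   element of L_2(mu), so this is the same as centers in L_2(mu). *)
Definition L2ball d (Omega : measurableType d) (R : realType)
    (mu : probability Omega R) (r : R) : set (Omega -> R) :=
  [set h | h \in Lfun mu 2%:E /\ ('N[mu]_2%:E[EFin \o h] <= r%:E)%E].

Definition local_entropy d (Omega : measurableType d) (R : realType)
    (mu : probability Omega R) (F : set (Omega -> R)) (r : R) : \bar R :=
  let M (f : Omega -> R) :=
    covering_number R ([set h - f | h in F] `&` L2ball mu (2 * r))
                      (L2ball mu r) in
  ereal_sup [set (r%:E * (lne (M f) `^ 2^-1))%E | f in F].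

(* The infimum of the empty set is +oo. *)
Definition q_star d (Omega : measurableType d) (R : realType)
    (mu : probability Omega R) (F : set (Omega -> R)) (N : nat) (eta : R)
    : \bar R :=
  ereal_inf [set s%:E | s in [set s : R | 0 < s /\
    (local_entropy mu F s <= (eta * s ^+ 2 * Num.sqrt N%:R)%:E)%E]].

Definition independent_rvs d d1 d2 (T : measurableType d)
    (T1 : measurableType d1) (T2 : measurableType d2) (R : realType)
    (P : probability T R) (X : T -> T1) (Y : T -> T2) : Prop :=
  forall A B, measurable A -> measurable B ->
    P (X @^-1` A `&` Y @^-1` B) = (P (X @^-1` A) * P (Y @^-1` B))%E.

(* Z_0, ..., Z_(N-1), defined on (T', P'), are i.i.d. with the law of Z, defined
   on (T, P).  The product rule for the whole family yields the one for every
   subfamily, by taking the remaining A i to be setT. *)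
Definition iid_copies d d' d1 (T : measurableType d) (T' : measurableType d')
    (S : measurableType d1) (R : realType) (P : probability T R) (Z : T -> S)
    (P' : probability T' R) (N : nat) (Zs : 'I_N -> T' -> S) : Prop :=
  [/\ forall i, measurable_fun setT (Zs i),
      forall i A, measurable A -> P' (Zs i @^-1` A) = P (Z @^-1` A) &
      forall A : 'I_N -> set S, (forall i, measurable (A i)) ->
        P' [set w | forall i, A i (Zs i w)] =
        (\prod_(i < N) P' (Zs i @^-1` A i))%E].

Definition risk d d' (Omega : measurableType d) (T : measurableType d')
    (R : realType) (P : probability T R) (X : T -> Omega) (Y : T -> R)
    (f : Omega -> R) : \bar R :=
  'E_P[fun w => (f (X w) - Y w) ^+ 2].

Definition learning_procedure (Omega : Type) (R : realType)
    (F : set (Omega -> R)) (N : nat)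
    (ftilde : N.-tuple (Omega * R) -> (Omega -> R)) : Prop :=
  forall D, F (ftilde D).

(* Since (X, Y) is independent of the data, the conditional expectation of
   (ftilde(X) - Y)^2 given the data D is the risk of the function ftilde D.
   As ftilde is an arbitrary map, the set of good outcomes need not be
   measurable: "with probability at least 1 - delta" means that it contains
   an event E of probability at least 1 - delta.  When it is measurable this
   says exactly that its probability is at least 1 - delta. *)
Definition performs d d' (Omega : measurableType d) (T : measurableType d')
    (R : realType) (P : probability T R) (X : T -> Omega) (Y : T -> R)
    (F : set (Omega -> R)) (N : nat)
    (ftilde : N.-tuple (Omega * R) -> (Omega -> R)) (eps delta : R) : Prop :=
  forall (dS : measure_display) (S : measurableType dS) (Q : probability S R)
      (XYs : 'I_N -> S -> Omega * R),
    iid_copies P (fun w => (X w, Y w)) Q XYs ->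
    exists E : set S,
      [/\ measurable E,
          ((1 - delta)%:E <= Q E)%E &
          forall w, E w ->
            (risk P X Y (ftilde [tuple XYs i w | i < N])
             <= ereal_inf [set risk P X Y f | f in F] + eps%:E)%E].

(* Main.v *)
(* Fix f0 in F. Let Z_1, ..., Z_N be i.i.d. copies of (X, W) under Q, and let the
   data be (X_i, f0(X_i) + W_i). For f in F, reweighting Q by the likelihood
   L = prod_i exp(a(X_i) W_i / s^2 - a(X_i)^2 / (2 s^2)), with a = f - f0, turns
   the same data into a sample of (X, f(X) + W), by Gaussian shift.  Since the risk
   of g for the target Y^f is |g - f|^2 + s^2, a procedure with accuracy eps
   lands, on an event E_f of reweighted probability > 3/4, within sqrt(eps) of f;
   if the functions f_0, ..., f_n of F are 2 sqrt(eps)-separated, these events are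
   disjoint. The event {L > n + 1} has small reweighted probability when
   N |f_j - f0|^2 / s^2 is small compared with ln(n + 1), and off it L <= n + 1;
   comparing the total masses gives ln(n + 1) <= 88 N max_j |f_j - f0|^2 / s^2.
   A maximal r-separated subset of F within 2r of f0, for any r > 2 sqrt(eps), then
   bounds the covering number, so that every such r is admissible in q*. *)
Require Import Defs.
From HB Require Import structures.
From mathcomp Require Import all_boot all_order all_algebra.
From mathcomp Require Import all_classical all_reals all_analysis.
From mathcomp Require Import measurable_realfun ring lra.

Set Implicit Arguments.
Unset Strict Implicit.
Unset Printing Implicit Defensive.

Import Order.TTheory GRing.Theory Num.Theory.
Import numFieldNormedType.Exports.

Local Open Scope classical_set_scope.
Local Open Scope ring_scope.

(** * Measures given by a density *)

Section density.
Context d (T : measurableType d) (R : realType).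
Variables (m : {measure set T -> \bar R}) (g : T -> R).
Local Open Scope ereal_scope.

(** The proofs of measurability and nonnegativity are arguments so that the measure structure
    declared below can be inferred from the term itself. *)
Definition density of measurable_fun setT g & (forall x, (0 <= g x)%R) :
    set T -> \bar R :=
  fun A => \int[m]_(x in A) (g x)%:E.

Variables (mg : measurable_fun setT g) (g0 : forall x, (0 <= g x)%R).

Let density0 : density mg g0 set0 = 0.
Proof. by rewrite /density integral_set0. Qed.

Let density_ge0 A : 0 <= density mg g0 A.
Proof. by rewrite /density integral_ge0// => x _; rewrite lee_fin. Qed.

Let density_sigma_additive : semi_sigma_additive (density mg g0).
Proof.
move=> A mA tA mUA; rewrite /density ge0_integral_bigcup//.
- by apply: is_cvg_ereal_nneg_natsum_cond => n _ _; exact: density_ge0.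
- by apply: (measurable_funS measurableT) => //; exact/measurable_EFinP.
- by move=> x _; rewrite lee_fin.
Qed.

HB.instance Definition _ := isMeasure.Build _ _ _ (density mg g0)
  density0 density_ge0 density_sigma_additive.

Import HBNNSimple.

(** Monotone convergence on both sides reduces the claim to the simple functions [h n]. For these it
    holds level set by level set, where it is the definition of [density]. *)
Lemma ge0_integral_density (f : T -> \bar R) :
  measurable_fun setT f -> (forall x, 0 <= f x) ->
  \int[density mg g0]_x f x = \int[m]_x (f x * (g x)%:E).
Proof.
move=> mf f0; have mE := @measurableT _ T.
have mgE : measurable_fun setT (EFin \o g) by exact/measurable_EFinP.
pose h := nnsfun_approx mE mf.
have -> : \int[density mg g0]_x f x =
    lim (\int[density mg g0]_x (EFin \o h n) x @[n --> \oo]).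
  have fE x : f x = lim ((EFin \o h n) x @[n --> \oo]).
    by apply/esym/cvg_lim => //; exact: cvg_nnsfun_approx.
  under eq_integral do rewrite fE.
  apply: monotone_convergence => //.
  - by move=> n; apply/measurable_EFinP.
  - by move=> n x _ //=; rewrite lee_fin.
  - by move=> x _ a b ab; rewrite lee_fin; exact/lefP/nd_nnsfun_approx.
have -> : \int[m]_x (f x * (g x)%:E) =
    lim (\int[m]_x ((h n x)%:E * (g x)%:E) @[n --> \oo]).
  have fg x : f x * (g x)%:E = lim ((h n x)%:E * (g x)%:E @[n --> \oo]).
    by apply/esym/cvg_lim => //; apply: cvgeZr => //; exact: cvg_nnsfun_approx.
  under eq_integral do rewrite fg.
  apply: monotone_convergence => //.
  - by move=> n; apply: emeasurable_funM => //; exact/measurable_EFinP.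
  - by move=> n x _ /=; rewrite mule_ge0 ?lee_fin.
  - move=> x _ a b ab/=; rewrite lee_wpmul2r ?lee_fin//.
    exact/lefP/nd_nnsfun_approx.
suff suf n : \int[m]_x ((h n x)%:E * (g x)%:E) =
    \int[density mg g0]_x (EFin \o h n) x.
  by under [in RHS]eq_fun do rewrite suf.
have indich r : measurable_fun setT
    (fun x => (r * \1_(h n @^-1` [set r]) x)%:E : \bar R).
  by apply/measurable_EFinP; exact: measurable_funM.
have hge r x : 0 <= (r * \1_(h n @^-1` [set r]) x)%:E.
  exact: nnfun_muleindic_ge0.
transitivity (\int[density mg g0]_x
   (\sum_(y \in range (h n)) (y * \1_(h n @^-1` [set y]) x)%:E)); last first.
  by apply: eq_integral => t tE; rewrite /= fimfunE -fsumEFin.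
rewrite ge0_integral_fsum//.
transitivity (\int[m]_x (\sum_(y \in range (h n))
    (y * \1_(h n @^-1` [set y]) x)%:E * (g x)%:E)).
  under [RHS]eq_integral => x xE.
    rewrite -ge0_mule_fsuml => //.
    rewrite fsumEFin // -(fimfunE _ x); over.
  by [].
rewrite ge0_integral_fsum//; last 2 first.
  - by move=> y; exact: emeasurable_funM.
  - by move=> r x _; rewrite mule_ge0 ?hge ?lee_fin.
apply: eq_fsbigr => r rhn.
under eq_integral do rewrite EFinM -muleA.
have [r0|r0] := leP 0%R r; last first.
  have e : h n @^-1` [set r] = set0 by rewrite preimage_nnfun0.
  rewrite e indic0 integral0_eq ?integral0_eq// => x _ /=.
    by rewrite mulr0.
  by rewrite mul0e mule0.
rewrite ge0_integralZl_EFin//; last 2 first.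
  - by move=> x _; rewrite mule_ge0 ?lee_fin.
  - by apply: emeasurable_funM => //; exact/measurable_EFinP/measurable_indic.
under [RHS]eq_integral do rewrite EFinM.
rewrite ge0_integralZl_EFin//; last exact/measurable_EFinP/measurable_indic.
rewrite [in RHS]integral_indic// setIT /= /density; congr (_ * _).
rewrite [RHS]integral_mkcond; apply: eq_integral => x _.
by rewrite patchE indicE; case: ifP; rewrite (mul1e, mul0e).
Qed.

End density.

(** * Invariance of Lebesgue measure under translation and reflection *)

Section lebesgue_translation.
Context {R : realType}.
Local Notation leb := (@lebesgue_measure R).

Let measurable_shift a : measurable_fun setT
  ((fun x => a + x) : measurableTypeR R -> measurableTypeR R).
Proof. exact: measurable_funD. Qed.

(** Lebesgue measure is determined by its values on half-open intervals, and the preimage of such an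
    interval is one of the same length. *)
Lemma lebesgue_measureD (a : R) (A : set R) : measurable A ->
  pushforward leb ((fun x => a + x) : _ -> measurableTypeR R) A = leb A.
Proof.
move=> mA.
pose mx := isMeasurableFun.Build _ _ _ _ _ (measurable_shift a).
pose ma : {mfun _ >-> _} := 
  HB.pack (_ : measurableTypeR R -> measurableTypeR R) mx.
apply/esym/(@lebesgue_measure_unique _ (pushforward leb ma)) => //=.
move=> _ [[u v]] _ <-; rewrite /pushforward.
have -> : (fun x => a + x) @^-1` `]u, v] = `]u - a, v - a]%classic.
  by apply/seteqP; split => x /=; rewrite !in_itv/= ltrBlDl lerBrDl.
rewrite !lebesgue_measure_itv/= !lte_fin ltrD2r; case: ifP => // _.
by rewrite -!EFinD; congr EFin; ring.
Qed.

Local Open Scope ereal_scope.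

Lemma ge0_integral_lebesgueD (a : R) (f : R -> \bar R) :
  measurable_fun setT f -> (forall x, 0 <= f x) ->
  \int[leb]_x f (a + x)%R = \int[leb]_x f x.
Proof.
move=> mf f0; transitivity (\int[pushforward leb
    ((fun x => a + x)%R : _ -> measurableTypeR R)]_x f x).
  by rewrite (ge0_integral_pushforward (measurable_shift a)).
by apply: eq_measure_integral => /= A mA _; exact: lebesgue_measureD.
Qed.

Lemma ge0_integral_lebesgueN (f : R -> \bar R) :
  measurable_fun setT f -> (forall x, 0 <= f x) ->
  \int[leb]_x f (- x)%R = \int[leb]_x f x.
Proof.
move=> mf f0.
transitivity (\int[pushforward leb (-%R : _ -> measurableTypeR R)]_x f x).
  by rewrite ge0_integral_pushforward.
by apply: eq_measure_integral => /= A mA _; exact: lebesgue_measureN.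
Qed.

End lebesgue_translation.

(** * Gaussian shift and second moment in dimension one *)

Section gaussian_shift.
Context {R : realType}.
Implicit Types s a w : R.

(* The density of N(a, s^2) with respect to N(0, s^2). *)
Definition gauss_ratio s a w : R :=
  expR (a * w / s ^+ 2 - a ^+ 2 / (2 * s ^+ 2)).

Lemma gauss_ratio_ge0 s a w : 0 <= gauss_ratio s a w.
Proof. exact: expR_ge0. Qed.

Lemma measurable_gauss_ratio s a : measurable_fun setT (gauss_ratio s a).
Proof.
apply: measurableT_comp => //; apply: measurable_funB => //.
by apply: measurable_funM => //; exact: measurable_funM.
Qed.

Lemma normal_pdf_shift s a w : 0 < s ->
  normal_pdf 0 s (w - a) = gauss_ratio s a w * normal_pdf 0 s w.
Proof.
move=> s0; rewrite !normal_pdfE ?gt_eqF// /normal_fun mulrCA -expRD.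
congr (_ * expR _); have := gt_eqF s0; move=> /negbT sn; field; lra.
Qed.

Lemma normal_pdfN s w : s != 0 -> normal_pdf 0 s (- w) = normal_pdf 0 s w.
Proof. by move=> sn; rewrite !normal_pdfE// /normal_fun !subr0 sqrrN. Qed.

Local Open Scope ereal_scope.

Lemma ge0_integral_normal m s (f : R -> \bar R) :
  measurable_fun setT f -> (forall x, 0 <= f x) ->
  \int[normal_prob m s]_x f x =
  \int[lebesgue_measure]_x (f x * (normal_pdf m s x)%:E).
Proof.
move=> mf f0; rewrite -(@ge0_integral_density _ (measurableTypeR R) R
  lebesgue_measure _ (measurable_normal_pdf m s) (normal_pdf_ge0 m s) f mf f0).
exact: eq_measure_integral.
Qed.

(** Cameron-Martin in dimension one: translation invariance moves the shift from [f] to the Gaussian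
    density, and expanding (w - a)^2 there produces [gauss_ratio]. *)
Lemma ge0_integral_normalD s a (f : R -> \bar R) : (0 < s)%R ->
  measurable_fun setT f -> (forall x, 0 <= f x) ->
  \int[normal_prob 0 s]_w f (a + w)%R =
  \int[normal_prob 0 s]_w (f w * (gauss_ratio s a w)%:E).
Proof.
move=> s0 mf f0.
have mg : measurable_fun setT (EFin \o gauss_ratio s a).
  by apply/measurable_EFinP; exact: measurable_gauss_ratio.
rewrite ge0_integral_normal//; last first.
  by apply: (measurableT_comp mf); exact: measurable_funD.
rewrite ge0_integral_normal//; last 2 first.
  - exact: emeasurable_funM.
  - by move=> w; rewrite mule_ge0// lee_fin gauss_ratio_ge0.
pose h y := f y * (normal_pdf 0 s (y - a))%:E.
transitivity (\int[@lebesgue_measure R]_x h (a + x)%R).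
  by apply: eq_integral => x _; rewrite /h [(a + x)%R]addrC addrK.
rewrite ge0_integral_lebesgueD//.
- by apply: eq_integral => x _; rewrite /h normal_pdf_shift// EFinM muleA.
- apply: emeasurable_funM => //; apply/measurable_EFinP.
  apply: (measurableT_comp (measurable_normal_pdf 0 s)).
  exact: measurable_funB.
- by move=> x; rewrite mule_ge0// lee_fin normal_pdf_ge0.
Qed.

Lemma ge0_integral_normalN s (f : R -> \bar R) : (0 < s)%R ->
  measurable_fun setT f -> (forall x, 0 <= f x) ->
  \int[normal_prob 0 s]_w f (- w)%R = \int[normal_prob 0 s]_w f w.
Proof.
move=> s0 mf f0.
rewrite !ge0_integral_normal//; last exact: (measurableT_comp mf).
pose h y := f y * (normal_pdf 0 s y)%:E.
transitivity (\int[@lebesgue_measure R]_x h (- x)%R).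
  by apply: eq_integral => x _; rewrite /h normal_pdfN// gt_eqF.
rewrite ge0_integral_lebesgueN//.
- apply: emeasurable_funM => //; apply/measurable_EFinP.
  exact: measurable_normal_pdf.
- by move=> x; rewrite mule_ge0// lee_fin normal_pdf_ge0.
Qed.

Lemma integral_gauss_ratio s a : (0 < s)%R ->
  \int[normal_prob 0 s]_w (gauss_ratio s a w)%:E = 1.
Proof.
move=> s0.
transitivity (\int[normal_prob 0 s]_w (cst 1 w * (gauss_ratio s a w)%:E)).
  by apply: eq_integral => x _; rewrite /= mul1e.
rewrite -(@ge0_integral_normalD s a (cst 1))//.
by rewrite integral_cst// mul1e; exact: probability_setT.
Qed.

(** An additive constant common to all risks below; once it is known to be finite it cancels when
    two risks are compared. *)
Definition gauss_var s : \bar R := \int[normal_prob 0 s]_w (w ^+ 2)%:E.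

(** With u = w / s, u^2 <= 2 (exp u + exp (-u)) by Taylor expansion. Up to the factor exp(1/2), the
    two exponentials are the densities [gauss_ratio] of the shifts by s and -s, each of integral
    1. *)
Lemma gauss_var_fin_num s : (0 < s)%R -> gauss_var s \is a fin_num.
Proof.
move=> s0; have sn : s != 0%R by rewrite gt_eqF.
have mg a : measurable_fun setT (fun w => (gauss_ratio s a w)%:E : \bar R).
  by apply/measurable_EFinP; exact: measurable_gauss_ratio.
rewrite ge0_fin_numE; last first.
  by apply: integral_ge0 => x _; rewrite lee_fin sqr_ge0.
pose c : R := (2 * s ^+ 2 * expR (2^-1))%R.
have c0 : (0 <= c)%R.
  by apply: mulr_ge0; [apply: mulr_ge0; rewrite ?sqr_ge0|exact: expR_ge0].
apply: (@le_lt_trans _ _ (\int[normal_prob 0 s]_w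
    (c%:E * ((gauss_ratio s s w)%:E + (gauss_ratio s (- s) w)%:E)))).
  apply: ge0_le_integral => //.
  - by move=> x _; rewrite lee_fin sqr_ge0.
  - by apply/measurable_EFinP; exact: exprn_measurable.
  - by apply: emeasurable_funM => //; apply: emeasurable_funD; exact: mg.
  move=> w _; rewrite -EFinD -EFinM lee_fin /gauss_ratio /c.
  set u := (w / s)%R.
  have -> : (s * w / s ^+ 2 - s ^+ 2 / (2 * s ^+ 2) = u - 2^-1)%R.
    by rewrite /u; field.
  have -> : (- s * w / s ^+ 2 - (- s) ^+ 2 / (2 * s ^+ 2) = - u - 2^-1)%R.
    by rewrite /u; field.
  have -> : (w ^+ 2 = s ^+ 2 * u ^+ 2)%R by rewrite /u; field.
  have -> : (2 * s ^+ 2 * expR 2^-1 * (expR (u - 2^-1) + expR (- u - 2^-1)) =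
      s ^+ 2 * (2 * (expR u + expR (- u))))%R.
    rewrite !expRD (expRN 2^-1); have := expR_gt0 (2^-1 : R).
    by move: (expR 2^-1) => e e0; field; rewrite gt_eqF.
  rewrite ler_wpM2l ?sqr_ge0//.
  have sq (v : R) : (0 <= v -> v ^+ 2 <= 2 * expR v)%R.
    move=> v0; have := expR_ge1Dxn 1 v0.
    by rewrite (_ : (2`!%:R = 2 :> R)%R)//; lra.
  have [u0|u0] := leP 0%R u.
    by have := sq u u0; have := expR_ge0 (- u); lra.
  have := sq (- u)%R; rewrite sqrrN.
  by have := expR_ge0 u; lra.
rewrite ge0_integralZl_EFin//; last 2 first.
  - by move=> x _; rewrite adde_ge0// lee_fin gauss_ratio_ge0.
  - by apply: emeasurable_funD; exact: mg.
have g0 a x : [set: R] x -> 0 <= (gauss_ratio s a x)%:E.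
  by move=> _; rewrite lee_fin gauss_ratio_ge0.
rewrite ge0_integralD//; try exact: g0; try exact: mg.
by rewrite !integral_gauss_ratio// -EFinD -EFinM ltry.
Qed.

(* The mean of (c - W)^2 and (c + W)^2 is c^2 + W^2, so that symmetry replaces
   the vanishing of the first moment. *)
Lemma integral_normal_sqrB s c : (0 < s)%R ->
  \int[normal_prob 0 s]_w ((c - w) ^+ 2)%:E = (c ^+ 2)%:E + gauss_var s.
Proof.
move=> s0; set I := LHS.
have mp (g : R -> R) : measurable_fun setT g ->
    measurable_fun setT (fun w => (g w ^+ 2)%:E : \bar R).
  by move=> mg; apply/measurable_EFinP; exact: measurable_funX.
have sq (g : R -> R) x : [set: R] x -> 0 <= (g x ^+ 2)%:E.
  by move=> _; rewrite lee_fin sqr_ge0.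
have IN : I = \int[normal_prob 0 s]_w ((c + w) ^+ 2)%:E.
  rewrite -(@ge0_integral_normalN s (fun w => ((c + w) ^+ 2)%:E))//.
  - by apply: mp; exact: measurable_funD.
  - by move=> w; rewrite lee_fin sqr_ge0.
have II : I + I = (c ^+ 2)%:E + gauss_var s + ((c ^+ 2)%:E + gauss_var s).
  rewrite {2}IN -ge0_integralD//; try exact: sq; try apply: mp;
    try exact: measurable_funB; try exact: measurable_funD.
  transitivity (\int[normal_prob 0 s]_w
     (((2 * c ^+ 2)%R)%:E + (2%:E * (w ^+ 2)%:E))).
    apply: eq_integral => w _; rewrite -EFinM -!EFinD; congr EFin.
    by rewrite /=; ring.
  rewrite ge0_integralD//; last 3 first.
    - by move=> x _; rewrite lee_fin mulr_ge0 ?sqr_ge0.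
    - by move=> x _; rewrite mule_ge0// lee_fin sqr_ge0.
    - by apply: emeasurable_funM => //; exact: mp.
  rewrite integral_cst//; have /= -> := @probability_setT _ _ _ (normal_prob 0 s).
  rewrite mule1 ge0_integralZl_EFin//; last 2 first.
    - by move=> x _; rewrite lee_fin sqr_ge0.
    - exact: mp.
  rewrite -/(gauss_var s) -(fineK (gauss_var_fin_num s0)).
  by rewrite -EFinM -!EFinD; congr EFin; ring.
have I0 : 0 <= I by apply: integral_ge0 => x _; rewrite lee_fin sqr_ge0.
move: II I0; rewrite -(fineK (gauss_var_fin_num s0)) -!EFinD.
by case: I IN => [i _| |] //= -[II] _; congr EFin; lra.
Qed.

End gaussian_shift.

(** * Independent copies on a product space *)

Section power_space.
Local Open Scope ereal_scope.

(** Independence is stated as factorisation of integrals because indicators of boxes, likelihoods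
    and their products all have this form. Induction on [N]: one more factor is multiplied on, read
    by the coordinate [ord_max], and Tonelli splits off its integral. *)
Lemma exists_power_space d (T : measurableType d) (R : realType)
    (P : probability T R) (N : nat) :
  exists (dS : measure_display) (S : measurableType dS) (Q : probability S R)
    (Z : 'I_N -> S -> T), (forall i, measurable_fun setT (Z i)) /\
    forall g : 'I_N -> T -> R, (forall i, measurable_fun setT (g i)) ->
      (forall i x, (0 <= g i x)%R) ->
      \int[Q]_s (\prod_(i < N) g i (Z i s))%:E =
      \prod_(i < N) \int[P]_x (g i x)%:E.
Proof.
elim: N => [|N [dS [S [Q [Z [mZ IH]]]]]].
  (* With no coordinates any probability space serves: the empty product integrates to the total
     mass 1. *)
  have Z0 : 'I_0 -> T -> T by case.
  exists d, T, P, Z0.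
  split; first by case.
  move=> g _ _; rewrite big_ord0.
  under eq_integral do rewrite big_ord0.
  by rewrite integral_cst// mul1e; exact: probability_setT.
pose Z' (i : 'I_N.+1) (s : S * T) : T :=
  if unlift ord_max i is Some j then Z j s.1 else s.2.
have mZ' i : measurable_fun setT (Z' i).
  rewrite /Z'; case: unliftP => [j _|_]; last exact: measurable_snd.
  exact: measurableT_comp.
exists _, (S * T)%type, (Q \x P), Z'; split=> // g mg g0.
have mpr n (h : 'I_n -> S -> T) (k : 'I_n -> T -> R) :
    (forall i, measurable_fun setT (h i)) ->
    (forall i, measurable_fun setT (k i)) ->
    measurable_fun setT (fun s => (\prod_(i < n) k i (h i s))%R).
  by move=> mh mk; apply: measurable_prod => i _; exact: measurableT_comp.
pose gl i := g (widen_ord (leqnSn N) i).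
transitivity (\int[Q \x P]_z
    ((\prod_(i < N) gl i (Z i z.1))%:E * (g ord_max z.2)%:E)).
  apply: eq_integral => z _; rewrite big_ord_recr/= EFinM; congr (_ %:E * _).
    apply: eq_bigr => i _; rewrite /Z'.
    rewrite /gl; have -> : widen_ord (leqnSn N) i = lift ord_max i.
      by apply: val_inj => /=; rewrite /bump leqNgt ltn_ord.
    by rewrite liftK.
  by rewrite /Z' unlift_none.
have pr0 s : 0 <= (\prod_(i < N) gl i (Z i s))%:E.
  by rewrite lee_fin; apply: prodr_ge0 => i _; exact: g0.
have mpr0 : measurable_fun setT
    (fun s => (\prod_(i < N) gl i (Z i s))%:E : \bar R).
  by apply/measurable_EFinP; apply: mpr => // i; exact: mg.
have mgl : measurable_fun setT (fun z => (g ord_max z)%:E : \bar R).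
  by apply/measurable_EFinP; exact: mg.
rewrite fubini_tonelli1//; last 2 first.
  - apply: emeasurable_funM.
      exact: (measurableT_comp mpr0 measurable_fst).
    exact: (measurableT_comp mgl measurable_snd).
  - by move=> z; rewrite mule_ge0// lee_fin g0.
rewrite /fubini_F/=; under eq_integral => s _.
  rewrite ge0_integralZl//; last by move=> x _; rewrite lee_fin g0.
  over.
rewrite ge0_integralZr//; last first.
  by apply: integral_ge0 => x _; rewrite lee_fin g0.
rewrite IH//; last 2 first.
  - by move=> i; exact: mg.
  - by move=> i x; exact: g0.
by rewrite big_ord_recr.
Qed.

End power_space.

(** * The law of (X, W), its shifts, and the risk in the regression model *)

Section regression_model.
Context d (Omega : measurableType d) (R : realType) (mu : probability Omega R).
Variable s : R.
Hypothesis s0 : 0 < s.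

(* normal_prob lives on measurableTypeR R, whose display is not that of R. *)
Definition gauss_prob : probability R R := distribution (normal_prob 0 s)
  (HB.pack_for {mfun measurableTypeR R >-> R} (idfun : measurableTypeR R -> R)
    (isMeasurableFun.Build _ _ (measurableTypeR R) R idfun
      (@measurable_id _ (measurableTypeR R) setT))).

Local Notation gauss := gauss_prob.

Lemma ge0_integral_gauss (f : R -> \bar R) :
  measurable_fun setT f -> (forall x, 0 <= f x)%E ->
  (\int[gauss]_x f x = \int[normal_prob 0 s]_x f x)%E.
Proof.
move=> mf f0; rewrite /gauss_prob /distribution.
by rewrite (ge0_integral_pushforward
  (@measurable_id _ (measurableTypeR R) setT : measurable_fun setT
     (idfun : measurableTypeR R -> R))).
Qed.

Definition design_noise : probability (Omega * R)%type R :=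
  (mu \x gauss)%E.

(** The density of the law of (X, a(X) + W) with respect to that of (X, W). *)
Definition shift_ratio (a : Omega -> R) (z : Omega * R) : R :=
  gauss_ratio s (a z.1) z.2.

Lemma shift_ratio_ge0 a z : 0 <= shift_ratio a z.
Proof. exact: gauss_ratio_ge0. Qed.

Lemma measurable_shift_ratio a : measurable_fun setT a ->
  measurable_fun setT (shift_ratio a).
Proof.
move=> ma; have ma1 : measurable_fun setT (fun z : Omega * R => a z.1).
  exact: measurableT_comp.
apply: measurableT_comp => //; apply: measurable_funB.
  by apply: measurable_funM => //; apply: measurable_funM.
by apply: measurable_funM => //; exact: measurable_funX.
Qed.

Local Open Scope ereal_scope.

(** For fixed x this is the Gaussian shift by the constant a(x); Tonelli then integrates over x. *)
Lemma integral_shift_ratio (a : Omega -> R) (h : Omega * R -> \bar R) :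
  measurable_fun setT a -> measurable_fun setT h -> (forall z, 0 <= h z) ->
  \int[design_noise]_z (h z * (shift_ratio a z)%:E) =
  \int[design_noise]_z h (z.1, a z.1 + z.2)%R.
Proof.
move=> ma mh h0.
have mr : measurable_fun setT (fun z => (shift_ratio a z)%:E : \bar R).
  by apply/measurable_EFinP; exact: measurable_shift_ratio.
rewrite !fubini_tonelli1//; last 3 first.
- apply: (measurableT_comp mh); apply: measurable_fun_pair => //.
  apply: measurable_funD => //; exact: measurableT_comp.
- exact: emeasurable_funM.
- by move=> z; rewrite mule_ge0// lee_fin shift_ratio_ge0.
apply: eq_integral => x _; rewrite /fubini_F/= /shift_ratio/=.
have mhx : measurable_fun setT (fun w => h (x, w)) by exact: measurableT_comp.
have mgx : measurable_fun setT (fun w => (gauss_ratio s (a x) w)%:E : \bar R).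
  by apply/measurable_EFinP; exact: measurable_gauss_ratio.
rewrite ge0_integral_gauss; last 2 first.
- exact: emeasurable_funM.
- by move=> w; rewrite mule_ge0// lee_fin gauss_ratio_ge0.
rewrite -(@ge0_integral_normalD _ s (a x) (fun w => h (x, w)))//.
by rewrite ge0_integral_gauss//; apply: (measurableT_comp mhx);
  exact: measurable_funD.
Qed.

Lemma integral_shift_ratio1 (a : Omega -> R) : measurable_fun setT a ->
  \int[design_noise]_z (shift_ratio a z)%:E = 1.
Proof.
move=> ma; transitivity (\int[design_noise]_z (cst 1 z * (shift_ratio a z)%:E)).
  by apply: eq_integral => z _; rewrite /= mul1e.
rewrite integral_shift_ratio// integral_cst// mul1e; exact: probability_setT.
Qed.

(** The shift moves only the second coordinate, so the reweighted law still has first marginal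
    [mu]. *)
Lemma integral_shift_ratio_fst (a b : Omega -> R) :
  measurable_fun setT a -> measurable_fun setT b -> (forall x, (0 <= b x)%R) ->
  \int[design_noise]_z (b z.1 * shift_ratio a z)%:E = \int[mu]_x (b x)%:E.
Proof.
move=> ma mb b0; under eq_integral do rewrite EFinM.
have mb1 : measurable_fun setT (fun z : Omega * R => (b z.1)%:E : \bar R).
  by apply/measurable_EFinP; exact: measurableT_comp.
rewrite (@integral_shift_ratio a (fun z => (b z.1)%:E))//; last first.
  by move=> z; rewrite lee_fin.
rewrite fubini_tonelli1//; last by move=> z; rewrite lee_fin.
apply: eq_integral => x _; rewrite /fubini_F/= integral_cst//.
by have /= -> := @probability_setT _ _ _ gauss; rewrite mule1.
Qed.

Section joint_law.
Context d' (T : measurableType d') (P : probability T R).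
Variables (X : T -> Omega) (W : T -> R).
Hypotheses (mX : measurable_fun setT X) (mW : measurable_fun setT W).
Hypothesis PX : forall A, measurable A -> P (X @^-1` A) = mu A.
Hypothesis PW : forall A, measurable A -> P (W @^-1` A) = normal_prob 0 s A.
Hypothesis XW : independent_rvs P X W.

Let mXW : measurable_fun setT (fun t => (X t, W t)).
Proof. exact: measurable_fun_pair. Qed.

Lemma integral_design_noise (h : Omega * R -> \bar R) :
  measurable_fun setT h -> (forall z, 0 <= h z) ->
  \int[P]_t h (X t, W t) = \int[design_noise]_z h z.
Proof.
move=> mh h0.
transitivity (\int[pushforward P (fun t => (X t, W t))]_z h z).
  by rewrite (ge0_integral_pushforward mXW).
pose mx := isMeasurableFun.Build _ _ _ _ _ mXW.
pose XWf : {mfun T >-> (Omega * R)%type} := HB.pack (fun t => (X t, W t)) mx.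
apply: (@eq_measure_integral _ _ _ _ design_noise (pushforward P XWf)).
move=> A mA _; apply/esym.
apply: (@product_measure_unique _ _ _ _ _ mu gauss (pushforward P XWf)) => //.
move=> B C mB mC; transitivity (P (X @^-1` B) * P (W @^-1` C)).
  exact: XW.
by rewrite PX// PW.
Qed.

(** Given X = x, the noise adds the same amount [gauss_var s] for every [g]; excess risk is
    therefore squared L_2 distance to [f]. *)
Lemma risk_regression (f g : Omega -> R) :
  measurable_fun setT f -> measurable_fun setT g ->
  risk P X (fun t => (f (X t) + W t)%R) g =
  \int[mu]_x ((g x - f x) ^+ 2)%:E + gauss_var s.
Proof.
move=> mf mg; rewrite /risk unlock/=.
pose h (z : Omega * R) : \bar R := ((g z.1 - (f z.1 + z.2)) ^+ 2)%:E.
have mgf : measurable_fun setT (fun x => (g x - f x)%R).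
  exact: measurable_funB.
have h0 z : 0 <= h z by rewrite lee_fin sqr_ge0.
have mh : measurable_fun setT h.
  apply/measurable_EFinP; apply: measurable_funX; apply: measurable_funB.
    exact: measurableT_comp.
  by apply: measurable_funD => //; exact: measurableT_comp.
rewrite (integral_design_noise mh h0) fubini_tonelli1//.
transitivity (\int[mu]_x (((g x - f x) ^+ 2)%:E + gauss_var s)).
  apply: eq_integral => x _; rewrite /fubini_F -integral_normal_sqrB//.
  rewrite ge0_integral_gauss//; last exact: (measurableT_comp mh).
  by apply: eq_integral => w _; rewrite /h /= opprD addrA.
rewrite ge0_integralD//.
- rewrite integral_cst//; have /= -> := @probability_setT _ _ _ mu.
  by rewrite mule1.
- by move=> x _; rewrite lee_fin sqr_ge0.
- by apply/measurable_EFinP; exact: measurable_funX.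
- by move=> x _; apply: integral_ge0 => w _; rewrite lee_fin sqr_ge0.
Qed.

End joint_law.
End regression_model.

(** * Likelihoods of shifted samples and the change-of-measure bound *)

(** U - A/2 plays the log-likelihood. Either it is at most t; or it exceeds t while 11 A < t, and
    then the exponents in the second bound differ by 10 U - 60 A - 5 t > 5 t - 55 A > 0; or 11 A / t
    >= 1 can be inserted as a weight, as in Markov's inequality. *)
Lemma exp_tail_cases (R : realType) (t U A : R) : 0 < t -> 0 <= A ->
  [\/ expR (U - A / 2) <= expR t,
      expR (U - A / 2) <= expR (- (5 * t)) * expR (11 * U - 121 * (A / 2)) |
      expR (U - A / 2) <= 11 / t * A * expR (U - A / 2)].
Proof.
move=> t0 A0; have [Ut|tU] := leP (U - A / 2) t.
  by apply: Or31; rewrite ler_expR.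
have [At|tA] := ltP (11 * A) t.
  by apply: Or32; rewrite -expRD ler_expR; lra.
apply: Or33; rewrite ler_peMl ?expR_ge0//.
by rewrite mulrAC ler_pdivlMr// mul1r.
Qed.

Section tilted_sample.
Context d (Omega : measurableType d) (R : realType) (mu : probability Omega R).
Variable s : R.
Hypothesis s0 : 0 < s.
Context dS (S : measurableType dS) (Q : probability S R) (N : nat).
Variable Z : 'I_N -> S -> Omega * R.
Hypothesis mZ : forall i, measurable_fun setT (Z i).
Hypothesis ZE : forall g : 'I_N -> Omega * R -> R,
  (forall i, measurable_fun setT (g i)) -> (forall i x, 0 <= g i x) ->
  (\int[Q]_w (\prod_(i < N) g i (Z i w))%:E =
   \prod_(i < N) \int[design_noise mu s]_z (g i z)%:E)%E.

Definition likelihood (a : Omega -> R) (w : S) : R :=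
  \prod_(i < N) shift_ratio s a (Z i w).

Lemma likelihood_ge0 a w : 0 <= likelihood a w.
Proof. by apply: prodr_ge0 => i _; exact: shift_ratio_ge0. Qed.

Lemma measurable_likelihood a : measurable_fun setT a ->
  measurable_fun setT (likelihood a).
Proof.
move=> ma; apply: measurable_prod => i _.
exact: (measurableT_comp (measurable_shift_ratio s ma)).
Qed.

Lemma likelihoodE a w : likelihood a w =
  expR ((\sum_(i < N) a (Z i w).1 * (Z i w).2 / s ^+ 2) -
        (\sum_(i < N) a (Z i w).1 ^+ 2 / s ^+ 2) / 2).
Proof.
rewrite /likelihood /shift_ratio /gauss_ratio -expR_sum; congr expR.
rewrite mulr_suml -sumrB; apply: eq_bigr => i _; congr (_ - _).
by rewrite invfM mulrA mulrAC.
Qed.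

(* 121 = 11^2: multiplying the likelihood of a by the Chernoff factor with
   exponent 10 gives the likelihood of 11 a. *)
Lemma likelihood_tail_le a w t : 0 < t ->
  likelihood a w <= expR t
    + expR (- (5 * t)) * likelihood (fun x => 11 * a x) w
    + 11 / (t * s ^+ 2) *
      \sum_(i < N) a (Z i w).1 ^+ 2 * likelihood a w.
Proof.
move=> t0; rewrite -mulr_suml.
have s2 : 0 < s ^+ 2 by rewrite exprn_gt0.
pose U := \sum_(i < N) a (Z i w).1 * (Z i w).2 / s ^+ 2.
pose B := \sum_(i < N) a (Z i w).1 ^+ 2.
have B0 : 0 <= B by apply: sumr_ge0 => i _; exact: sqr_ge0.
have LE : likelihood a w = expR (U - B / s ^+ 2 / 2).
  by rewrite likelihoodE /U /B [in RHS](mulr_suml _ _ _ (s ^- 2)).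
have ME : likelihood (fun x => 11 * a x) w =
    expR (11 * U - 121 * (B / s ^+ 2 / 2)).
  rewrite likelihoodE /U /B; congr (expR (_ - _)).
    by rewrite mulr_sumr; apply: eq_bigr => i _; rewrite !mulrA.
  rewrite !mulr_suml mulr_sumr; apply: eq_bigr => i _.
  by rewrite exprMn; ring.
have Bs : 0 <= B / s ^+ 2 by rewrite divr_ge0// ltW.
have e1 := expR_ge0 t.
have e2 := mulr_ge0 (expR_ge0 (- (5 * t)))
  (likelihood_ge0 (fun x => 11 * a x) w).
have e3 : 0 <= 11 / (t * s ^+ 2) * (B * likelihood a w).
  rewrite mulr_ge0 ?divr_ge0 ?mulr_ge0 ?likelihood_ge0//; exact: ltW.
move: e2 e3; rewrite -/B ME LE.
have [h|h|h] := exp_tail_cases U t0 Bs; [lra|lra|].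
have -> : 11 / (t * s ^+ 2) * (B * expR (U - B / s ^+ 2 / 2)) =
    11 / t * (B / s ^+ 2) * expR (U - B / s ^+ 2 / 2).
  by rewrite invfM; ring.
lra.
Qed.

Local Open Scope ereal_scope.

Lemma integral_likelihood (a : Omega -> R) : measurable_fun setT a ->
  \int[Q]_w (likelihood a w)%:E = 1.
Proof.
move=> ma; rewrite (ZE (fun=> measurable_shift_ratio s ma)); last first.
  by move=> _; exact: shift_ratio_ge0.
by rewrite big1// => i _; exact: integral_shift_ratio1.
Qed.

Lemma integral_sqr_likelihood (a : Omega -> R) i : measurable_fun setT a ->
  \int[Q]_w (a (Z i w).1 ^+ 2 * likelihood a w)%:E =
  \int[mu]_x (a x ^+ 2)%:E.
Proof.
move=> ma.
(* The square is absorbed into factor [i], so that the integrand is again a product over the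
   coordinates; the other factors integrate to 1. *)
pose g j z := ((if j == i then a z.1 ^+ 2 else 1) * shift_ratio s a z)%R.
have mg j : measurable_fun setT (g j).
  apply: measurable_funM; last exact: measurable_shift_ratio.
  case: (j == i) => //; apply: measurable_funX.
  exact: (measurableT_comp ma measurable_fst).
have g0 j z : (0 <= g j z)%R.
  by rewrite mulr_ge0 ?shift_ratio_ge0//; case: ifP => //; rewrite sqr_ge0.
transitivity (\int[Q]_w (\prod_(j < N) g j (Z j w))%:E).
  apply: eq_integral => w _; congr EFin.
  rewrite /likelihood /g big_split/=; congr (_ * _)%R.
  by rewrite -big_mkcond/= big_pred1_eq.
rewrite ZE// (bigD1 i)//= big1 ?mule1 => [|j ji]; last first.
  rewrite -[RHS](integral_shift_ratio1 mu s0 ma); apply: eq_integral => z _.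
  by rewrite /g (negbTE ji) mul1r.
rewrite -(integral_shift_ratio_fst mu s0 ma (measurable_funX 2 ma)) => [|x].
  by apply: eq_integral => z _; rewrite /g eqxx.
exact: sqr_ge0.
Qed.

(** The pointwise tail bound is integrated: the term exp t stays restricted to [E], while the other
    two are enlarged to the whole space, where the likelihood of 11 a has mass 1 and the weighted
    sum is at most N v. *)
Lemma integral_likelihood_tail (a : Omega -> R) (v t : R) (E : set S) :
  measurable_fun setT a -> \int[mu]_x (a x ^+ 2)%:E <= v%:E -> (0 < t)%R ->
  measurable E ->
  \int[Q]_(w in E) (likelihood a w)%:E <=
  (expR t)%:E * Q E
    + (expR (- (5 * t)) + 11 * N%:R * v / (t * s ^+ 2))%:E.
Proof.
move=> ma av t0 mE.
pose b x := (11 * a x)%R.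
have mb : measurable_fun setT b by exact: measurable_funM.
have mL c : measurable_fun setT c ->
    measurable_fun setT (fun w => (likelihood c w)%:E : \bar R).
  by move=> mc; apply/measurable_EFinP; exact: measurable_likelihood.
have L0 c w : 0 <= (likelihood c w)%:E by rewrite lee_fin likelihood_ge0.
have mA i : measurable_fun setT
    (fun w => (a (Z i w).1 ^+ 2 * likelihood a w)%:E : \bar R).
  apply/measurable_EFinP; apply: measurable_funM.
    apply: measurable_funX.
    exact: (measurableT_comp (measurableT_comp ma measurable_fst) (mZ i)).
  exact: measurable_likelihood.
have A0 i w : 0 <= (a (Z i w).1 ^+ 2 * likelihood a w)%:E.
  by rewrite lee_fin mulr_ge0 ?sqr_ge0 ?likelihood_ge0.
have k0 : (0 <= 11 / (t * s ^+ 2))%R.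
  by rewrite divr_ge0// mulr_ge0 ?sqr_ge0// ltW.
pose r1 w := (expR t)%:E * (\1_E w)%:E.
pose r2 w := (expR (- (5 * t)))%:E * (likelihood b w)%:E.
pose r3 w := (11 / (t * s ^+ 2))%:E *
  \sum_(i < N) (a (Z i w).1 ^+ 2 * likelihood a w)%:E.
have mI : measurable_fun setT (fun w : S => (\1_E w)%:E : \bar R).
  by apply/measurable_EFinP; exact: measurable_indic.
have mr1 : measurable_fun setT r1 by exact: emeasurable_funM.
have mr2 : measurable_fun setT r2 by apply: emeasurable_funM => //; exact: mL.
have mr3 : measurable_fun setT r3.
  by apply: emeasurable_funM => //; exact: emeasurable_sum.
have r10 w : 0 <= r1 w by rewrite mule_ge0 ?lee_fin ?expR_ge0.
have r20 w : 0 <= r2 w by rewrite mule_ge0 ?lee_fin ?expR_ge0 ?likelihood_ge0.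
have sA0 w : 0 <= \sum_(i < N) (a (Z i w).1 ^+ 2 * likelihood a w)%:E.
  by apply: sume_ge0 => i _.
have r30 w : 0 <= r3 w by rewrite mule_ge0// lee_fin.
apply: (@le_trans _ _ (\int[Q]_w (r1 w + r2 w + r3 w))).
  rewrite integral_mkcond; apply: ge0_le_integral => //.
  - by move=> w _; rewrite patchE; case: ifP.
  - apply/(measurable_restrictT _ _).1 => //.
    exact: (measurable_funS measurableT _ (mL a ma)).
  - by apply: emeasurable_funD => //; exact: emeasurable_funD.
  move=> w _; rewrite patchE /r1 indicE; case: ifP => wE; last first.
    by rewrite mule0 add0e adde_ge0.
  rewrite mule1 /r2 /r3 sumEFin -!EFinM -!EFinD lee_fin.
  exact: likelihood_tail_le.
rewrite ge0_integralD//; try exact: emeasurable_funD; last first.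
  by move=> w _; rewrite adde_ge0.
rewrite ge0_integralD//.
rewrite -addeA; apply: leeD.
  rewrite ge0_integralZl_EFin ?expR_ge0//.
  by rewrite integral_indic// setIT.
rewrite ge0_integralZl_EFin ?expR_ge0//; last exact: mL.
rewrite integral_likelihood// mule1 EFinD leeD2lE//.
rewrite ge0_integralZl_EFin//; last exact: emeasurable_sum.
rewrite ge0_integral_sum//.
apply: (@le_trans _ _ ((11 / (t * s ^+ 2))%:E * \sum_(i < N) v%:E)).
  rewrite lee_wpmul2l ?lee_fin//; apply: lee_sum => i _.
  by rewrite integral_sqr_likelihood.
rewrite sumEFin -EFinM lee_fin sumr_const card_ord -mulr_natr.
by rewrite le_eqVlt; apply/orP; left; apply/eqP; ring.
Qed.

Local Close Scope ereal_scope.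

(* Summing the tail bound over j != 0 needs no choice of a best index: the total
   Q-mass of these events is at most 1/4, because E_0 already has 3/4. *)
Lemma ln_packing_le (n : nat) (a : 'I_n.+1 -> Omega -> R) (E : 'I_n.+1 -> set S)
    (v : R) :
  (forall j, measurable_fun setT (a j)) -> (forall x, a ord0 x = 0) ->
  (forall j, \int[mu]_x (a j x ^+ 2)%:E <= v%:E)%E ->
  (forall j, measurable (E j)) -> trivIset setT E ->
  (forall j, (3 / 4)%:E <= \int[Q]_(w in E j) (likelihood (a j) w)%:E)%E ->
  ln n.+1%:R <= 88 * N%:R * v / s ^+ 2.
Proof.
move=> ma a0 av mE tE Qa.
have s2 : 0 < s ^+ 2 by rewrite exprn_gt0.
have v0 : 0 <= v.
  rewrite -lee_fin; apply: le_trans (av ord0).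
  by apply: integral_ge0 => x _; rewrite lee_fin sqr_ge0.
have [->|n0] := posnP n.
  by rewrite ln1 divr_ge0 ?mulr_ge0// ltW.
(* This threshold makes exp t = n + 1; it is positive because n = 0 has been set aside. *)
pose t : R := ln n.+1%:R.
have t0 : 0 < t by rewrite ln_gt0// ltr1n.
have et : expR t = n.+1%:R by rewrite lnK// posrE.
pose q j := fine (Q (E j)).
have qE j : (q j)%:E = Q (E j) by rewrite fineK// fin_num_measure.
(* Since [a ord0] vanishes, its likelihood is 1 and the hypothesis bounds the [Q]-mass itself. *)
have q0 : 3 / 4 <= q ord0.
  rewrite -lee_fin qE; apply: (le_trans (Qa ord0)).
  rewrite (eq_integral (cst 1%E)) ?integral_cst ?mul1e// => w _.
  rewrite /likelihood big1// => i _.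
  by rewrite /shift_ratio /gauss_ratio a0 mul0r mul0r expr0n/= mul0r subrr expR0.
have sq : \sum_j q j <= 1.
  rewrite -lee_fin -sumEFin; under eq_bigr do rewrite qE.
  pose D := \big[setU/set0]_(j <- index_enum 'I_n.+1) E j.
  have mD : measurable D by apply: bigsetU_measurable => j _; exact: mE.
  have := @ge0_integral_bigsetU _ _ _ Q _ E (cst 1%E) (index_enum 'I_n.+1) mE
    (index_enum_uniq _) (sub_trivIset (@subsetT _ _) tE).
  rewrite /= -/D integral_cst// mul1e.
  move=> /(_ (measurable_cst _) (fun _ _ => lee01)) QD.
  under eq_bigr do rewrite -[Q _]mul1e -integral_cst//.
  by rewrite -QD; exact: probability_le1.
pose k := expR (- (5 * t)) + 11 * N%:R * v / (t * s ^+ 2).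
have tail j : 3 / 4 <= expR t * q j + k.
  have := le_trans (Qa j) (integral_likelihood_tail (ma j) (av j) t0 (mE j)).
  by rewrite -qE -EFinM -EFinD lee_fin.
have : \sum_(j < n.+1 | j != ord0) (3 / 4 : R) <=
    \sum_(j < n.+1 | j != ord0) (expR t * q j + k).
  by apply: ler_sum => j _; exact: tail.
have cardE (c : R) : \sum_(j < n.+1 | j != ord0) c = n%:R * c.
  by rewrite sumr_const cardC1 card_ord mulr_natl.
rewrite big_split/= !cardE -mulr_sumr et.
move: sq; rewrite (bigD1 ord0)//=.
set q' := \sum_(j < n.+1 | j != ord0) q j => sq.
have n1 : 1 <= n%:R :> R by rewrite ler1n.
have q'4 : q' <= 1 / 4 by lra.
(* As n >= 1, (n + 1)/4 <= n/2. Averaging the tail bounds over j != 0 then leaves 3/4 <= 1/2 + k. *)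
have nq : n.+1%:R * q' <= n%:R * (1 / 2).
  apply: (@le_trans _ _ (n.+1%:R * (1 / 4))); first by rewrite ler_wpM2l.
  by rewrite -natr1; lra.
move=> h; have {h} : n%:R * (3 / 4) <= n%:R * (1 / 2 + k).
  by rewrite mulrDr; apply: (le_trans h); rewrite lerD2r.
rewrite ler_pM2l; last by lra.
(* exp(-5t) = (n + 1)^(-5) <= 2^(-5), so k >= 1/4 leaves at least 1/8 for the term 11 N v / (t s^2);
   hence the constant 88 = 8 * 11. *)
have e5 : expR (- (5 * t)) <= 1 / 32.
  have n2 : 2 <= n.+1%:R :> R by rewrite ler_nat.
  rewrite expRN -[5]/(5%:R) expRM_natl et div1r lef_pV2 ?posrE ?exprn_gt0//.
  by apply: (@le_trans _ _ (2 ^+ 5)); [lra|rewrite lerXn2r ?nnegrE].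
rewrite /k => kk; have : 1 / 8 <= 11 * N%:R * v / (t * s ^+ 2) by lra.
rewrite ler_pdivlMr ?mulr_gt0// => h.
by rewrite -/t ler_pdivlMr//; lra.
Qed.

Local Open Scope ereal_scope.

Section sample_law.
Context d' (T : measurableType d') (P : probability T R).
Variables (X : T -> Omega) (W : T -> R).
Hypotheses (mX : measurable_fun setT X) (mW : measurable_fun setT W).
Hypothesis PX : forall A, measurable A -> P (X @^-1` A) = mu A.
Hypothesis PW : forall A, measurable A -> P (W @^-1` A) = normal_prob 0 s A.
Hypothesis XW : independent_rvs P X W.
Variables (f0 f : Omega -> R).
Hypotheses (mf0 : measurable_fun setT f0) (mf : measurable_fun setT f).

(** The data map involves [f0] alone and only the measure depends on [f]. The law is checked on
    boxes, whose indicator times the likelihood is a product over the coordinates, so that [ZE]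
    applies. *)
Lemma exists_tilted_sample :
  exists Q' : probability S R,
    (forall E, measurable E ->
       Q' E = \int[Q]_(w in E) (likelihood (fun x => f x - f0 x)%R w)%:E) /\
    iid_copies P (fun t => (X t, f (X t) + W t)%R) Q'
      (fun i w => ((Z i w).1, f0 (Z i w).1 + (Z i w).2)%R).
Proof.
pose a x := (f x - f0 x)%R.
have ma : measurable_fun setT a by exact: measurable_funB.
pose m := density Q (measurable_likelihood ma) (likelihood_ge0 a).
have m1 : m setT = 1 by exact: integral_likelihood.
pose Q' : probability S R := HB.pack_for (probability S R) m
  (Measure_isProbability.Build _ _ _ m m1).
exists Q'; split=> //.
pose Y (z : Omega * R) := (z.1, f0 z.1 + z.2)%R.
have mY : measurable_fun setT Y.
  apply: measurable_fun_pair => //; apply: measurable_funD => //.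
  exact: measurableT_comp.
pose V t := (X t, f (X t) + W t)%R.
have mV : measurable_fun setT V.
  apply: measurable_fun_pair => //; apply: measurable_funD => //.
  exact: measurableT_comp.
have mYZ i : measurable_fun setT (fun w => Y (Z i w)).
  exact: measurableT_comp.
have one A : measurable A ->
    \int[design_noise mu s]_z (\1_A (Y z) * shift_ratio s a z)%:E =
    P (V @^-1` A).
  move=> mA; under eq_integral do rewrite EFinM.
  have mIA : measurable_fun setT (fun z : Omega * R => (\1_A z)%:E : \bar R).
    by apply/measurable_EFinP; exact: measurable_indic.
  rewrite (@integral_shift_ratio _ _ _ mu s s0 a (fun z => (\1_A (Y z))%:E))//;
    last exact: (measurableT_comp mIA mY).
  have mg : measurable_fun setT
      (fun z : Omega * R => (\1_A (Y (z.1, a z.1 + z.2)%R))%:E : \bar R).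
    have mS : measurable_fun setT
        (fun z : Omega * R => (z.1, a z.1 + z.2)%R : Omega * R).
      apply: measurable_fun_pair => //; apply: measurable_funD => //.
      exact: measurableT_comp.
    exact: (measurableT_comp mIA (measurableT_comp mY mS)).
  rewrite -(integral_design_noise mX mW PX PW XW mg); last first.
    by move=> z; rewrite lee_fin.
  have mVA : measurable (V @^-1` A).
    by rewrite -[X in measurable X]setTI; exact: mV.
  transitivity (\int[P]_t (\1_(V @^-1` A) t)%:E); last first.
    by rewrite integral_indic// setIT.
  apply: eq_integral => t _; rewrite !indicE.
  suff -> : Y (X t, a (X t) + W t)%R = V t by [].
  by rewrite /Y /V /a /= addrA [(f0 _ + _)%R]addrC subrK.
have all A : (forall i, measurable (A i)) ->
    Q' [set w | forall i, A i (Y (Z i w))] = \prod_(i < N) P (V @^-1` A i).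
  move=> mA; rewrite /= /m /density integral_mkcond.
  pose g i z := (\1_(A i) (Y z) * shift_ratio s a z)%R.
  transitivity (\int[Q]_w (\prod_(i < N) g i (Z i w))%:E).
    apply: eq_integral => w _; rewrite patchE /g big_split/=.
    case: ifPn => [/set_mem wA|wA].
      by rewrite big1 ?mul1r// => i _; rewrite indicE mem_set.
    have [i wAi] : exists i, ~ A i (Y (Z i w)).
      apply/existsNP => wA'; move/negP: wA; apply; exact/mem_set.
    by rewrite (bigD1 i)//= indicE memNset// !mul0r.
  rewrite ZE; first by apply: eq_bigr => i _; exact: one.
  - move=> i; apply: measurable_funM; last exact: measurable_shift_ratio.
    exact: (measurableT_comp (measurable_indic (mA i)) mY).
  - by move=> i z; rewrite mulr_ge0 ?shift_ratio_ge0.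
have single i A : measurable A ->
    Q' ((fun w => Y (Z i w)) @^-1` A) = P (V @^-1` A).
  move=> mA.
  (* The marginal law is the box formula with all other sides equal to the whole space. *)
  have := all (fun j => if j == i then A else setT).
  rewrite (bigD1 i)//= eqxx big1 ?mule1 => [<-|j /negbTE ->]; last 2 first.
  - by move=> j; case: ifP.
  - by rewrite preimage_setT probability_setT.
  congr m; apply/seteqP; split=> w /=.
    by move=> Aw j; case: eqP => // ->.
  by move/(_ i); rewrite eqxx.
split=> // A mA; rewrite all//; apply: eq_bigr => i _.
exact/esym/(single i _ (mA i)).
Qed.

End sample_law.
End tilted_sample.

(** * Squared L_2 distance *)

Section square_distance.
Context d (Omega : measurableType d) (R : realType) (mu : probability Omega R).
Local Open Scope ereal_scope.

Definition dist2 (f g : Omega -> R) : \bar R :=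
  \int[mu]_x ((f x - g x) ^+ 2)%:E.

Lemma dist2C f g : dist2 f g = dist2 g f.
Proof. by apply: eq_integral => x _; rewrite -opprB sqrrN. Qed.

Lemma dist2xx f : dist2 f f = 0.
Proof. by apply: integral0_eq => x _; rewrite subrr expr0n. Qed.

(** Pointwise (u - v)^2 + (u + v)^2 = 2 (u^2 + v^2). The factor 2 is why accuracy eps is matched
    with squared separation 4 eps. *)
Lemma dist2_triangle (h f g : Omega -> R) :
  measurable_fun setT h -> measurable_fun setT f -> measurable_fun setT g ->
  dist2 f g <= 2%:E * (dist2 h f + dist2 h g).
Proof.
move=> mh mf mg.
have md (u v : Omega -> R) : measurable_fun setT u -> measurable_fun setT v ->
    measurable_fun setT (fun x => ((u x - v x) ^+ 2)%:E : \bar R).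
  move=> mu' mv; apply/measurable_EFinP; apply: measurable_funX.
  exact: measurable_funB.
have d0 (u v : Omega -> R) x : 0 <= ((u x - v x) ^+ 2)%:E.
  by rewrite lee_fin sqr_ge0.
rewrite /dist2 -ge0_integralD//; try (by move=> x _; exact: d0); try exact: md.
have mD : measurable_fun setT
    (fun x => ((h x - f x) ^+ 2)%:E + ((h x - g x) ^+ 2)%:E : \bar R).
  by apply: emeasurable_funD; exact: md.
rewrite -ge0_integralZl_EFin//; last by move=> x _; rewrite adde_ge0.
apply: ge0_le_integral => //; first exact: md.
- exact: emeasurable_funM.
- move=> x _; rewrite -EFinD -EFinM lee_fin.
  by have := sqr_ge0 ((h x - f x) + (h x - g x)); lra.
Qed.

Lemma measurable_Lfun (p : \bar R) (f : Omega -> R) :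
  f \in Lfun mu p -> measurable_fun setT f.
Proof. by rewrite inE => /andP[+ _]; rewrite inE. Qed.

End square_distance.

(** * From accuracy of the procedure to a bound on separated families *)

Section procedure.
Context d (Omega : measurableType d) (R : realType) (mu : probability Omega R).
Variable F : set (Omega -> R).
Context d' (T : measurableType d') (P : probability T R).
Variables (X : T -> Omega) (W : T -> R) (sigma : R) (N : nat).
Variables (ftilde : N.-tuple (Omega * R) -> (Omega -> R)) (eps delta : R).
Hypothesis F2 : forall f, F f -> f \in Lfun mu 2%:E.
Hypothesis mX : measurable_fun setT X.
Hypothesis PX : forall A, measurable A -> P (X @^-1` A) = mu A.
Hypothesis sigma0 : 0 < sigma.
Hypothesis mW : measurable_fun setT W.
Hypothesis PW : forall A, measurable A -> P (W @^-1` A) = normal_prob 0 sigma A.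
Hypothesis XW : independent_rvs P X W.
Hypothesis ftildeF : learning_procedure F ftilde.
Hypothesis delta4 : delta < 4^-1.
Hypothesis perf :
  forall f, F f -> performs P X (fun w => f (X w) + W w) F ftilde eps delta.

Let mF f : F f -> measurable_fun setT f.
Proof. by move=> /F2; exact: measurable_Lfun. Qed.

(** The infimum is at most the risk of [f] itself, which is the noise variance; this finite quantity
    cancels. *)
Lemma dist2_le_accuracy f g : F f -> F g ->
  (risk P X (fun w => (f (X w) + W w)%R) g <=
   ereal_inf [set risk P X (fun w => (f (X w) + W w)%R) h | h in F]
     + eps%:E)%E ->
  (dist2 mu g f <= eps%:E)%E.
Proof.
move=> Ff Fg h; have := le_trans h (leeD2r _ (ereal_inf_lbound _)).
move=> /(_ (risk P X (fun w => (f (X w) + W w)%R) f)).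
move=> /(_ (ex_intro2 _ _ f Ff erefl)).
have rE := risk_regression sigma0 mX mW PX PW XW.
rewrite !rE; try exact: mF.
rewrite -/(dist2 mu g f) -/(dist2 mu f f) dist2xx add0e addeC.
by rewrite leeD2lE// gauss_var_fin_num.
Qed.

(** All targets share one data map [D], so at each outcome the procedure returns a single function,
    which cannot be close to two separated ones: the good events are disjoint. *)
Lemma ln_separated_le n (f : 'I_n.+1 -> Omega -> R) (v : R) :
  (forall j, F (f j)) ->
  (forall j, (dist2 mu (f j) (f ord0) <= v%:E)%E) ->
  (forall i j, i != j -> ((4 * eps)%:E < dist2 mu (f i) (f j))%E) ->
  ln n.+1%:R <= 88 * N%:R * v / sigma ^+ 2.
Proof.
move=> Ff fv sep.
have [dS [S [Q [Z [mZ ZE]]]]] := exists_power_space (design_noise mu sigma) N.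
pose f0 := f ord0.
pose D w := [tuple ((Z i w).1, f0 (Z i w).1 + (Z i w).2) | i < N].
pose a j x := f j x - f0 x.
have /choice[E EP] (j : 'I_n.+1) : exists E : set S, [/\ measurable E,
    ((3 / 4)%:E <= \int[Q]_(w in E) (likelihood sigma Z (a j) w)%:E)%E &
    forall w, E w -> (dist2 mu (ftilde (D w)) (f j) <= eps%:E)%E].
  have [Q' [Q'E iid]] := exists_tilted_sample sigma0 mZ ZE mX mW PX PW XW
    (mF (Ff ord0)) (mF (Ff j)).
  have [E [mE QE risk_le]] := perf (Ff j) iid.
  exists E; split=> //; last first.
    by move=> w /risk_le; apply: dist2_le_accuracy => //; exact: ftildeF.
  rewrite -Q'E//; apply: le_trans QE; rewrite lee_fin; move: delta4; lra.
apply: (@ln_packing_le _ _ _ mu _ sigma0 _ _ Q _ _ mZ ZE _ a E) => //.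
- by move=> j; apply: measurable_funB; exact: (mF (Ff _)).
- by move=> x; rewrite /a subrr.
- by move=> j; have [] := EP j.
- apply/trivIsetP => i j _ _ ij; apply/seteqP; split => // w [Ei Ej].
  have [_ _ /(_ _ Ei) hi] := EP i; have [_ _ /(_ _ Ej) hj] := EP j.
  have Fw : F (ftilde (D w)) by exact: ftildeF.
  have := dist2_triangle mu (mF Fw) (mF (Ff i)) (mF (Ff j)).
  move=> /(lt_le_trans (sep _ _ ij)) /lt_le_trans.
  move=> /(_ (2%:E * (eps%:E + eps%:E))%E); rewrite lee_wpmul2l ?leeD//.
  by move=> /(_ isT); rewrite -EFinD -EFinM lte_fin; lra.
- by move=> j; have [] := EP j.
Qed.

End procedure.

(** * Covering numbers and separated families *)

Section covering.
Context d (Omega : measurableType d) (R : realType) (mu : probability Omega R).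

Lemma Lnorm2E (h : Omega -> R) :
  ('N[mu]_2%:E[EFin \o h] = (\int[mu]_x (h x ^+ 2)%:E) `^ 2^-1)%E.
Proof.
rewrite unlock; congr poweR; apply: eq_integral => x _ /=.
by rewrite powR_mulrn// -normrX ger0_norm ?sqr_ge0.
Qed.

Lemma L2ballP (r : R) (h : Omega -> R) : 0 <= r ->
  L2ball mu r h <->
  measurable_fun setT h /\ (\int[mu]_x (h x ^+ 2)%:E <= (r ^+ 2)%:E)%E.
Proof.
move=> r0.
have nE : ('N[mu]_2%:E[EFin \o h] <= r%:E)%E =
    (\int[mu]_x (h x ^+ 2)%:E <= (r ^+ 2)%:E)%E.
  rewrite Lnorm2E.
  have : (0 <= \int[mu]_x (h x ^+ 2)%:E)%E.
    by apply: integral_ge0 => x _; rewrite lee_fin sqr_ge0.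
  case: (\int[mu]_x (h x ^+ 2)%:E)%E => [i| |] //.
    rewrite lee_fin => i0; rewrite poweR_EFin !lee_fin powR12_sqrt//.
    by rewrite -[in LHS](ger0_norm r0) -sqrtr_sqr ler_sqrt ?sqr_ge0.
  by move=> _; rewrite poweRyr ?invr_eq0 ?pnatr_eq0.
split=> [[hL]|[mh hr]]; first by
  rewrite nE; split => //; exact: measurable_Lfun hL.
split; last by rewrite nE.
rewrite inE; apply/andP; split; rewrite inE//=.
by rewrite /finite_norm; apply: le_lt_trans (ltry r); rewrite nE.
Qed.

(* A maximal r-separated family centred at f is an r-net. *)
Lemma covering_number_le (F : set (Omega -> R)) (f : Omega -> R) (r B : R) :
  (forall g, F g -> measurable_fun setT g) -> F f -> 0 < r ->
  (forall n (g : 'I_n.+1 -> Omega -> R), g ord0 = f ->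
    (forall j, F (g j)) ->
    (forall j, (dist2 mu (g j) (g ord0) <= ((2 * r) ^+ 2)%:E)%E) ->
    (forall i j, i != j -> ((r ^+ 2)%:E < dist2 mu (g i) (g j))%E) ->
    ln n.+1%:R <= B) ->
  exists n, ln n.+1%:R <= B /\
    (covering_number R ([set (h - f)%R | h in F] `&` L2ball mu (2 * r)%R)
       (L2ball mu r) <= n.+1%:R%:E)%E.
Proof.
move=> mF Ff r0 sepB.
pose sep n (g : 'I_n.+1 -> Omega -> R) := [/\ g ord0 = f,
  forall j, F (g j),
  forall j, (dist2 mu (g j) (g ord0) <= ((2 * r) ^+ 2)%:E)%E &
  forall i j, i != j -> ((r ^+ 2)%:E < dist2 mu (g i) (g j))%E].
pose p n := `[< exists g, sep n g >].
have p0 : p 0%N.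
  apply/asboolP; exists (fun=> f); split => //.
    by move=> j; rewrite dist2xx lee_fin sqr_ge0.
  by move=> i j; rewrite !ord1 eqxx.
(* A separated family of n + 1 functions has n + 1 <= exp B, so a largest one exists. *)
have pB n : p n -> (n <= Num.bound (expR B))%N.
  move=> /asboolP[g [g0 Fg gr gs]]; have := sepB n g g0 Fg gr gs.
  rewrite -ler_expR lnK ?posrE// => h.
  have := le_lt_trans h (archi_boundP (expR_ge0 B)).
  by rewrite ltr_nat => /ltnW/ltnW.
case: (ex_maxnP (ex_intro _ 0%N p0) pB) => n /asboolP[g [g0 Fg gr gs]] nmax.
exists n; split; first exact: (sepB n g).
have net h : F h -> (dist2 mu h f <= ((2 * r) ^+ 2)%:E)%E ->
    exists j, (dist2 mu h (g j) <= (r ^+ 2)%:E)%E.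
  move=> Fh hf; apply: contrapT => /forallNP far.
  have farj j : ((r ^+ 2)%:E < dist2 mu h (g j))%E.
    by rewrite ltNge; apply/negP; exact: far.
  (* A function far from all [g j] is appended in last place, so that index 0 still carries the
     centre [f]; this contradicts maximality. *)
  pose g' (i : 'I_n.+2) := if unlift ord_max i is Some j then g j else h.
  have g'0 : g' ord0 = f.
    rewrite /g'.
    have -> : ord0 = lift ord_max (ord0 : 'I_n.+1) by exact: val_inj.
    by rewrite liftK.
  have : p n.+1.
    apply/asboolP; exists g'; split => //.
    - by move=> j; rewrite /g'; case: unliftP.
    - by move=> j; rewrite g'0 /g'; case: unliftP => // k _; rewrite -g0.
    - move=> i j; rewrite /g'; case: unliftP => [k|] ->;
        case: unliftP => [l|] ->.
      + by move=> kl; apply: gs; apply: contraNneq kl => ->.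
      + by move=> _; rewrite dist2C.
      + by move=> _.
      + by rewrite eqxx.
  by move/nmax; rewrite ltnn.
apply: ereal_inf_lbound; exists n.+1 => //=.
(* The net is recentred with the class: h - f = (g_j - f) + (h - g_j). *)
exists (fun j => g j - f) => u [[h Fh <-]].
have r20 : 0 <= 2 * r by rewrite mulr_ge0// ltW.
move=> /(L2ballP _ r20) [_ hf].
have [j hj] := net h Fh hf.
exists j; exists (h - g j); last by rewrite [RHS]addrC addrA subrK.
apply/(L2ballP _ (ltW r0)); split => //.
by apply: measurable_funB; apply: mF.
Qed.

(** The set contains f - f = 0, so an empty cover is impossible; this keeps the logarithm in the
    entropy nonnegative. *)
Lemma covering_number_ge1 (F : set (Omega -> R)) (f : Omega -> R) (r : R) :
  F f -> 0 <= r ->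
  (1%:E <= covering_number R ([set (h - f)%R | h in F] `&` L2ball mu (2 * r)%R)
     (L2ball mu r))%E.
Proof.
move=> Ff r0; apply: le_ereal_inf_tmp => _ [n [c cov] <-].
rewrite lee_fin ler1n lt0n; apply/eqP => n0; subst n.
have [|[]//] := cov 0; split; first by exists f => //; rewrite subrr.
apply/L2ballP; first by rewrite mulr_ge0.
split; first by rewrite -[0]/(cst 0).
rewrite integral0_eq ?lee_fin ?sqr_ge0// => x _.
by rewrite /= expr0n.
Qed.

End covering.

(** * The lower bound on the accuracy *)

Theorem theoremB (R : realType) :
  exists c1 c1' : R, 0 < c1 /\ 0 < c1' /\
  forall (d : measure_display) (Omega : measurableType d)
    (mu : probability Omega R) (F : set (Omega -> R))
    (d' : measure_display) (T : measurableType d') (P : probability T R)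
    (X : T -> Omega) (W : T -> R) (sigma : R) (N : nat)
    (ftilde : N.-tuple (Omega * R) -> (Omega -> R)) (eps delta : R),
  (forall f, F f -> f \in Lfun mu 2%:E) ->
  measurable_fun setT X ->
  (forall A, measurable A -> P (X @^-1` A) = mu A) ->
  0 < sigma ->
  measurable_fun setT W ->
  (forall A, measurable A -> P (W @^-1` A) = normal_prob 0 sigma A) ->
  independent_rvs P X W ->
  learning_procedure F ftilde ->
  delta < 4^-1 ->
  (forall f, F f -> performs P X (fun w => f (X w) + W w) F ftilde eps delta) ->
  (c1%:E * q_star mu F N (c1' / sigma) ^+ 2 <= eps%:E)%E.
Proof.
(* 1/4 comes from q* <= 2 sqrt(eps), squared. 40 comes from the entropy bound at radius 2r, which
   requires 88 * 4 = 352 <= 40^2. *)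
exists 4^-1, 40; split; [by rewrite invr_gt0|split => //].
move=> d Omega mu F d' T P X W sigma N ftilde eps delta F2 mX PX sigma0 mW PW.
move=> XW ftildeF delta4 perf.
have sep_le := ln_separated_le F2 mX PX sigma0 mW PW XW ftildeF delta4 perf.
have mF f : F f -> measurable_fun setT f by move=> /F2; exact: measurable_Lfun.
have Ff0 : F (ftilde [tuple (point, 0) | i < N]) by exact: ftildeF.
have eps0 : 0 <= eps.
  (* If eps were negative, two equal functions would count as separated, since 0 > 4 eps; their
     distance bound v = 0 would give ln 2 <= 0. *)
  rewrite leNgt; apply/negP => eps0.
  have : ln 2%:R <= 88 * N%:R * 0 / sigma ^+ 2.
    apply: (sep_le 1%N (fun=> ftilde [tuple (point, 0) | i < N])) => //
      [_|i j _].
      by rewrite dist2xx.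
    by rewrite dist2xx lte_fin; lra.
  by rewrite mulr0 mul0r leNgt ln_gt0// ltr1n.
have entropy_le (r : R) : 2 * Num.sqrt eps < r ->
    (local_entropy mu F r <= (40 / sigma * r ^+ 2 * Num.sqrt N%:R)%:E)%E.
  move=> er; have r0 : 0 < r by apply: le_lt_trans er; rewrite mulr_ge0.
  have er2 : 4 * eps < r ^+ 2.
    have -> : 4 * eps = (2 * Num.sqrt eps) ^+ 2.
      by rewrite exprMn sqr_sqrtr//; ring.
    by rewrite ltrXn2r ?nnegrE ?mulr_ge0// ltW.
  apply: ge_ereal_sup => _ [f Ff <-].
  have [|n [nB covn]] := @covering_number_le _ _ _ mu F f r
      (88 * N%:R * (2 * r) ^+ 2 / sigma ^+ 2) mF Ff r0.
    move=> n g _ Fg gr gs; apply: (sep_le n g) => // i j ij.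
    by apply: lt_trans (gs i j ij); rewrite lte_fin.
  have cov1 := covering_number_ge1 mu Ff (ltW r0).
  move: covn cov1; set M := covering_number _ _ _.
  case: M => [M| |] //; rewrite !lee_fin => Mn M1.
  have M0 : 0 < M by apply: lt_le_trans M1.
  rewrite lne_EFin// poweR_EFin powR12_sqrt ?ln_ge0// -EFinM lee_fin.
  have -> : 40 / sigma * r ^+ 2 * Num.sqrt N%:R =
      r * (40 / sigma * r * Num.sqrt N%:R) by ring.
  rewrite ler_pM2l//.
  have b0 : 0 <= 40 / sigma * r * Num.sqrt N%:R.
    by rewrite !mulr_ge0// ?invr_ge0 ltW.
  rewrite -[leRHS](ger0_norm b0) -sqrtr_sqr ler_sqrt ?sqr_ge0//.
  apply: (@le_trans _ _ (ln n.+1%:R)); first by rewrite ler_ln ?posrE.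
  apply: (le_trans nB); rewrite !exprMn sqr_sqrtr// exprVn.
  have k0 : 0 <= N%:R * r ^+ 2 / sigma ^+ 2.
    by apply: divr_ge0; [apply: mulr_ge0; rewrite ?ler0n ?sqr_ge0|
      rewrite sqr_ge0].
  by lra.
have q_le : (q_star mu F N (40 / sigma) <= (2 * Num.sqrt eps)%:E)%E.
  (* Admissibility is known only for radii strictly above 2 sqrt(eps), hence the slack [e], which
     also keeps the radius positive when eps = 0. *)
  apply/lee_addgt0Pr => e e0; apply: ereal_inf_lbound.
  exists (2 * Num.sqrt eps + e) => //; split.
    by rewrite ltr_wpDl// mulr_ge0.
  by apply: entropy_le; rewrite ltrDl.
have q_ge0 : (0 <= q_star mu F N (40 / sigma))%E.
  by apply: le_ereal_inf_tmp => _ [r [r0 _] <-]; rewrite lee_fin ltW.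
move: q_le q_ge0; case: (q_star _ _ _ _) => [q| |] //.
rewrite !lee_fin => qe q0.
have : q ^+ 2 <= (2 * Num.sqrt eps) ^+ 2 by rewrite lerXn2r ?nnegrE ?mulr_ge0.
by rewrite exprMn sqr_sqrtr// expr2; lra.
Qed.
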